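(* Let $m$ and $n$ be positive integers with $m\ge n$. There exists an $n$-dimensional, compact, connected, ancient solution $(M_t)_{t\in(-\infty,0)}$ to the mean curvature flow in $\mathbb{R}^{2m}$ such that, for every $t<0$, $M_t$ does not lie in any $(2m-1)$-dimensional Euclidean subspace of $\mathbb{R}^{2m}$.
   Context: A family of immersed $n$-dimensional submanifolds $M_t\subset\mathbb{R}^N$ is a solution to the mean curvature flow if its position vector $x$ satisfies $\partial_t x=-\vec{H}$, where $\vec H$ is minus the trace of the second fundamental form; equivalently $\partial_t x=\Delta_{M_t}x$, where $\Delta_{M_t}$ is the Laplace–Beltrami operator of the metric induced on $M_t$, applied to each coordinate. A solution is ancient if it is defined for all $t\in(-\infty,0)$. A Euclidean subspace means an affine subspace (not necessarily through the origin). Compact and connected mean that each $M_t$ is compact and connected. *)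

(* Defs.v *)
From HB Require Import structures.
From mathcomp Require Import all_boot all_order all_algebra.
From mathcomp Require Import all_classical all_reals all_analysis.

Set Implicit Arguments.
Unset Strict Implicit.
Unset Printing Implicit Defensive.

Import Order.TTheory GRing.Theory Num.Theory.
Import numFieldNormedType.Exports.

Local Open Scope classical_set_scope.
Local Open Scope ring_scope.

Fixpoint iter_derive (R : realType) (V W : normedModType R) (vs : seq V)
    (f : V -> W) : V -> W :=
  if vs is v :: vs' then 'D_v (iter_derive vs' f) else f.

(* C^oo on an open set U: f and all its iterated directional derivatives are
   differentiable at the points of U.  Only used for finite-dimensional V. *)
Definition smooth_on (R : realType) (V W : normedModType R) (U : set V)
    (f : V -> W) : Prop :=
  forall (vs : seq V) (x : V), U x -> differentiable (iter_derive vs f) x.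

(* The values of coord i outside dom i, and of param i outside target i, are
   irrelevant. *)
Record smooth_manifold (R : realType) (n : nat) := SmoothManifold {
  carrier :> topologicalType ;
  chart : Type ;
  dom : chart -> set carrier ;
  target : chart -> set 'rV[R]_n ;
  coord : chart -> carrier -> 'rV[R]_n ;
  param : chart -> 'rV[R]_n -> carrier ;
  manifold_hausdorff : hausdorff_space carrier ;
  manifold_second_countable : @second_countable carrier ;
  dom_cover : forall x, exists i, dom i x ;
  dom_open : forall i, open (dom i) ;
  target_open : forall i, open (target i) ;
  coord_target : forall i x, dom i x -> target i (coord i x) ;
  param_dom : forall i u, target i u -> dom i (param i u) ;
  coordK : forall i x, dom i x -> param i (coord i x) = x ;
  paramK : forall i u, target i u -> coord i (param i u) = u ;
  coord_continuous : forall i, {within dom i, continuous (coord i)} ;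
  param_continuous : forall i, {within target i, continuous (param i)} ;
  transition_smooth : forall i j,
    smooth_on (target i `&` param i @^-1` dom j) (coord j \o param i)
}.

Arguments dom {R n M} i _ : rename.
Arguments target {R n M} i _ : rename.
Arguments coord {R n M} i _ : rename.
Arguments param {R n M} i _ : rename.

(* Extrinsic geometry of an immersion X of an open subset of R^n into R^N.
   The rows of the n x N matrix 'J X u are the tangent vectors
   d_0 X, ..., d_(n-1) X at u. *)
Section extrinsic_geometry.
Variables (R : realType) (n N : nat).
Implicit Types (X : 'rV[R]_n -> 'rV[R]_N) (u : 'rV[R]_n).

Definition induced_metric X u : 'M[R]_n := 'J X u *m ('J X u)^T.

(* v *m tangent_proj X u is the orthogonal projection of v on the tangent
   space, that is, the sum over a, b of g^{ab} <v, d_a X> d_b X. *)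
Definition tangent_proj X u : 'M[R]_N :=
  ('J X u)^T *m invmx (induced_metric X u) *m 'J X u.

(* A(d_a X, d_b X): the normal component of d_a d_b X. *)
Definition second_fundamental_form X u (a b : 'I_n) : 'rV[R]_N :=
  'D_(delta_mx 0 a) ('D_(delta_mx 0 b) X) u *m (1%:M - tangent_proj X u).

Definition mean_curvature X u : 'rV[R]_N :=
  - \sum_(a < n) \sum_(b < n)
      invmx (induced_metric X u) a b *: second_fundamental_form X u a b.

End extrinsic_geometry.

(* A smooth family F t (t in the open time set I) of immersions of M in R^N
   with d_t F = - H.  The values of F t for t outside I are irrelevant. *)
Definition mean_curvature_flow (R : realType) (n N : nat) (I : set R)
    (M : smooth_manifold R n) (F : R -> M -> 'rV[R]_N) : Prop :=
  forall i : chart M,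
  [/\ smooth_on (I `*` target i)
        (fun z : R * 'rV[R]_n => F z.1 (param i z.2)),
      forall t u, I t -> target i u -> row_free ('J (F t \o param i) u)
    & forall t u, I t -> target i u ->
        derive1 (F ^~ (param i u)) t = - mean_curvature (F t \o param i) u].

Definition ancient_mean_curvature_flow (R : realType) (n N : nat)
    (M : smooth_manifold R n) (F : R -> M -> 'rV[R]_N) : Prop :=
  mean_curvature_flow [set t | t < 0] F.

Definition affine_subspace (R : realType) (N : nat) (p : 'rV[R]_N)
    (V : {vspace 'rV[R]_N}) : set 'rV[R]_N :=
  [set y | y - p \in V].

(* Main.v *)
(** The torus R^n / (2 pi Z)^n is sent to C^m by
    F_t(u)_j = r_j(t) exp(i k_j u_(a(j))), where k_j = j + 1 and a maps
    {0, .., m-1} onto {0, .., n-1}.  The induced metric is the constant diagonal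
    matrix with entries D_a = sum_(a(j) = a) k_j^2 r_j^2 and the second
    derivatives of F_t in the coordinate directions are normal, so mean
    curvature flow becomes r_j' = - k_j^2 r_j / D_(a(j)).  It is solved by
    r_j = exp(- k_j^2 tau_(a(j))) as soon as tau_a' = 1 / D_a, that is, when
    tau_a is the inverse function of
    x |-> - 1/2 sum_(a(j) = a) exp(- 2 k_j^2 x), a bijection from R to the
    negative reals.  Along the diagonal u = (s, .., s) the 2m coordinates are
    nonzero multiples of cos(k_j s) and sin(k_j s) with distinct k_j > 0, which
    are linearly independent together with the constants; hence no affine
    hyperplane contains the image. *)

Require Import Defs.
From HB Require Import structures.
From mathcomp Require Import all_boot all_order all_algebra.
From mathcomp Require Import all_classical all_reals all_analysis.
From mathcomp Require Import ring lra.

Import Order.TTheory GRing.Theory Num.Theory.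
Import numFieldNormedType.Exports.

Local Open Scope classical_set_scope.
Local Open Scope ring_scope.

(** * Smoothness of functions generated by a family closed under derivation *)

(** Differentiability is local: [g] inherits the first-order expansion of [f] at [x]. This allows a
    derivative to be replaced by a formula valid only on an open set. *)
Lemma near_eq_differentiable {R : realType} {V W : normedModType R}
    (f g : V -> W) (x : V) :
  {near x, f =1 g} -> differentiable f x -> differentiable g x.
Proof.
move=> fg df; have fgx : f x = g x := nbhs_singleton fg.
have gE : g \o shift x = cst (g x) + 'd f x +o_ 0 id.
  apply/eqaddoP => _/posnumP[e].
  have /diff_locally/eqaddoP/(_ e%:num)/(_ [gt0 of e%:num]) := df.
  apply: filter_app.
  have : \forall h \near 0, f (h + x) = g (h + x).
    have := fg; rewrite (near_shift 0).
    by apply: filterS => h /=; rewrite subr0.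
  apply: filterS => h fgh.
  rewrite -[X in _ -> `|X| <= _]/(g (h + x) - (g x + 'd f x h)).
  by rewrite -fgh -fgx.
have dE := diff_unique (diff_continuous df) gE.
by apply/diff_locallyP; rewrite dE; split => //; exact: diff_continuous.
Unshelve. all: by end_near. Qed.

(** By induction on the directions, each iterated derivative agrees on [U] with a member of [P].
    Since [U] is open, this is agreement near each of its points, which is enough to derive once
    more and to transfer differentiability. *)
Lemma smooth_on_coinduction {R : realType} {V W : normedModType R} (U : set V)
    (P : (V -> W) -> Prop) :
    open U ->
    (forall f x, P f -> U x -> differentiable f x) ->
    (forall f v, P f -> exists2 g, P g & {in U, 'D_v f =1 g}) ->
  forall f, P f -> smooth_on U f.
Proof.
move=> Uopen Pdiff Pderive f Pf.
have near_U (g h : V -> W) x : {in U, g =1 h} -> U x -> {near x, g =1 h}.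
  move=> gh Ux; near=> y; apply: gh; rewrite inE; near: y.
  exact: open_nbhs_nbhs.
have step vs : exists2 g, P g & {in U, iter_derive vs f =1 g}.
  elim: vs => [|v vs [g Pg fg]] /=; first by exists f.
  have [h Ph gh] := Pderive g v Pg; exists h => // x Ux.
  rewrite -gh//; apply: near_eq_derive; apply: near_U fg _; exact: set_mem.
move=> vs x Ux; have [g Pg fg] := step vs.
apply: near_eq_differentiable (Pdiff _ _ Pg Ux).
by apply: near_U => // y Uy; rewrite fg.
Unshelve. all: by end_near. Qed.

Lemma derive_comp {R : realType} {V : normedModType R} (f : R -> R) (l : R)
    (L : V -> R) (x v : V) :
  is_derive (L x) 1 f l -> differentiable L x ->
  differentiable (f \o L) x /\ 'D_v (f \o L) x = l * 'D_v L x.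
Proof.
move=> [fd <-] Ld.
have fd' : differentiable f (L x) by exact/derivable1_diffP.
have cd : differentiable (f \o L) x by exact: differentiable_comp.
split=> //; rewrite deriveE//.
by rewrite diff_comp//= deriv1E// derive1E -(deriveE v Ld) [LHS]mulrC.
Qed.

Lemma fst_differentiable {R : realType} {V W : normedModType R} (z : V * W) :
  differentiable fst z.
Proof. by apply: linear_differentiable => x; exact: cvg_fst. Qed.

Lemma snd_differentiable {R : realType} {V W : normedModType R} (z : V * W) :
  differentiable snd z.
Proof. by apply: linear_differentiable => x; exact: cvg_snd. Qed.

Lemma derive_fst {R : realType} {V W : normedModType R} (z v : V * W) :
  'D_v fst z = v.1.
Proof.
rewrite deriveE; last exact: fst_differentiable.
by rewrite diff_lin//= => x; exact: cvg_fst.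
Qed.

Lemma derive_coord {R : realType} {n : nat} (j : 'I_n) (u v : 'rV[R]_n) :
  'D_v (fun w : 'rV[R]_n => w 0 j) u = v 0 j.
Proof.
have /(congr1 (fun w : 'rV[R]_n => w 0 j)) :=
  @derive_mx _ 'rV[R]_n _ _ id u v (@derivable_id _ _ u v).
by rewrite derive_id mxE.
Qed.

(** The polynomial expressions in the [e i]. By the Leibniz rule this algebra is closed under
    derivation as soon as it contains the derivatives of its generators. *)
Inductive generated_algebra {R : realType} {V : Type} {I : Type}
    (e : I -> V -> R) : (V -> R) -> Prop :=
  | GenCst c : generated_algebra e (fun=> c)
  | GenVar i : generated_algebra e (e i)
  | GenAdd f g : generated_algebra e f -> generated_algebra e g ->
      generated_algebra e (fun x => f x + g x)
  | GenMul f g : generated_algebra e f -> generated_algebra e g ->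
      generated_algebra e (fun x => f x * g x).

Lemma generated_algebra_sum {R : realType} {V I J : Type} (e : I -> V -> R)
    (r : seq J) (P : pred J) (F : J -> V -> R) :
  (forall j, P j -> generated_algebra e (F j)) ->
  generated_algebra e (fun x => \sum_(j <- r | P j) F j x).
Proof.
move=> FA; elim: r => [|j r IHr].
  rewrite (_ : (fun _ => _) = fun=> 0); first exact: GenCst.
  by apply/funext => x; rewrite big_nil.
have [Pj|nPj] := boolP (P j).
  rewrite (_ : (fun _ => _) = fun x => F j x + \sum_(j <- r | P j) F j x).
    by apply: GenAdd => //; exact: FA.
  by apply/funext => x; rewrite big_cons Pj.
by under eq_fun do rewrite big_cons (negbTE nPj).
Qed.

Lemma differentiable_rV {R : realType} {V : normedModType R} {n : nat}
    (F : V -> 'rV[R]_n) (x : V) :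
  (forall j, differentiable (fun y => F y 0 j) x) -> differentiable F x.
Proof.
move=> dF.
rewrite (_ : F = \sum_(j < n) fun y => F y 0 j *: delta_mx 0 j).
  by apply: differentiable_sum => j; exact: differentiableZl.
by apply/funext => y; rewrite fct_sumE [LHS]row_sum_delta.
Qed.

Lemma derive_rV {R : realType} {V : normedModType R} {n : nat}
    (F : V -> 'rV[R]_n) (x v : V) (j : 'I_n) :
  differentiable F x -> ('D_v F x) 0 j = 'D_v (fun y => F y 0 j) x.
Proof. by move=> dF; rewrite derive_mx ?mxE//; exact: diff_derivable. Qed.

Section smooth_generated_algebra.
Context {R : realType} {V : normedModType R} {I : Type}.
Variables (U : set V) (e : I -> V -> R).
Hypothesis diff_e : forall i x, U x -> differentiable (e i) x.
Hypothesis derive_e : forall i v,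
  exists2 g, generated_algebra e g & {in U, 'D_v (e i) =1 g}.

Lemma generated_algebra_differentiable f x :
  generated_algebra e f -> U x -> differentiable f x.
Proof.
move=> fA Ux; elim: fA => [c|i|g h _ dg _ dh|g h _ dg _ dh].
- exact: differentiable_cst.
- exact: diff_e.
- exact: differentiableD.
- exact: differentiableM.
Qed.

Lemma generated_algebra_derive f v : generated_algebra e f ->
  exists2 g, generated_algebra e g & {in U, 'D_v f =1 g}.
Proof.
elim=> [c|i|g h gA [g' g'A gg'] hA [h' h'A hh']|
        g h gA [g' g'A gg'] hA [h' h'A hh']].
- by exists (fun=> 0); [exact: GenCst|move=> x _; exact: derive_cst].
- exact: derive_e.
- exists (fun x => g' x + h' x); first exact: GenAdd.
  move=> x Ux; rewrite -gg'// -hh'//; move/set_mem in Ux.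
  by apply: deriveD; apply: diff_derivable;
    exact: generated_algebra_differentiable.
- exists (fun x => g x * h' x + h x * g' x).
    by apply: GenAdd; apply: GenMul.
  move=> x Ux; rewrite -gg'// -hh'//; move/set_mem in Ux.
  by apply: deriveM; apply: diff_derivable;
    exact: generated_algebra_differentiable.
Qed.

(** Coinduction on the class of maps all of whose coordinates lie in the algebra. *)
Lemma smooth_on_generated_algebra n (F : V -> 'rV[R]_n) : open U ->
  (forall j, generated_algebra e (fun x => F x 0 j)) -> smooth_on U F.
Proof.
move=> Uopen; move: F; apply: smooth_on_coinduction => // [F x FA Ux|F v FA].
  by apply: differentiable_rV => j; exact: generated_algebra_differentiable.
have /choice[g gP] : forall j, exists g, generated_algebra e g /\
    {in U, 'D_v (fun x => F x 0 j) =1 g}.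
  by move=> j; have [g] := generated_algebra_derive _ v (FA j); exists g.
exists (fun x => \row_j g j x).
  by move=> j; under eq_fun do rewrite mxE; have [] := gP j.
move=> x Ux; apply/rowP => j; rewrite derive_rV ?mxE.
  by have [_ ->] := gP j.
apply: differentiable_rV => k.
exact: generated_algebra_differentiable (FA k) (set_mem Ux).
Qed.

End smooth_generated_algebra.

(** * The torus *)

(** When [cos x] is positive, [atan (tan x)] and [x] differ by a multiple of 2 pi, so an angle
    recovered through [atan] still describes the same point of the circle. *)
Lemma cos_atan_tan {R : realType} (x : R) :
  0 < cos x -> cos (atan (tan x)) = cos x.
Proof.
move=> cx; rewrite cos_atan -cos2_tan2 ?gt_eqF//.
by rewrite sqrtrV ?sqr_ge0// sqrtr_sqr ger0_norm ?invrK// ltW.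
Qed.

Lemma sin_atan_tan {R : realType} (x : R) :
  0 < cos x -> sin (atan (tan x)) = sin x.
Proof.
move=> cx; have cx0 : cos x != 0 by rewrite gt_eqF.
have /(congr1 ( *%R^~ (cos x))) := atanK (tan x).
by rewrite {1}/tan cos_atan_tan// /tan !divfK.
Qed.

(** [acos (cos x)] has the right cosine, and the right sine up to sign; negate it when [sin x] is
    negative. This makes the torus the image of a compact cube. *)
Lemma principal_angle {R : realType} (x : R) :
  exists y, [/\ y \in `[- pi, pi], cos y = cos x & sin y = sin x].
Proof.
have cx : -1 <= cos x <= 1 by rewrite cos_geN1 cos_le1.
have cy : cos (acos (cos x)) = cos x by rewrite acosK ?in_itv.
have sy : sin (acos (cos x)) = `|sin x|.
  by rewrite sin_acos// -sin2cos2 sqrtr_sqr.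
have y0 := acos_ge0 cx; have ypi := acos_lepi cx.
have [sx|sx] := leP 0 (sin x).
  exists (acos (cos x)); split => //; last by rewrite sy ger0_norm.
  by rewrite in_itv/= ypi andbT (le_trans _ y0)// oppr_le0 pi_ge0.
exists (- acos (cos x)); split; last by rewrite sinN sy ltr0_norm// opprK.
  by rewrite in_itv/= lerN2 ypi/= (le_trans _ (pi_ge0 R))// oppr_le0.
by rewrite cosN.
Qed.

Lemma inj_hausdorff {S T : topologicalType} (f : S -> T) :
  continuous f -> injective f -> hausdorff_space T -> hausdorff_space S.
Proof.
move=> cf finj hT x y xy; apply/finj/hT => A B fxA fyB.
by have [z [Az Bz]] := xy _ _ (cf _ _ fxA) (cf _ _ fyB); exists (f z).
Qed.

Definition cos_sin {R : realType} {n : nat} (u : 'rV[R]_n) :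
  'rV[R]_n * 'rV[R]_n := (map_mx cos u, map_mx sin u).

(** The quotient of R^n by (2 pi Z)^n, realised as a product of unit circles so that it carries a
    subspace topology. *)
Definition torus (R : realType) (n : nat) : set ('rV[R]_n * 'rV[R]_n) :=
  range cos_sin.

Definition torus_point {R : realType} {n : nat} (u : 'rV[R]_n) : torus R n :=
  exist _ (cos_sin u) (mem_set (imageT cos_sin u)).

Lemma torus_pointP {R : realType} {n : nat} (z : torus R n) :
  exists u, z = torus_point u.
Proof.
case: z => z zT; have [u _ uz] := set_mem zT.
by exists u; apply: val_inj => /=.
Qed.

HB.instance Definition _ (R : realType) (n : nat) :=
  isPointed.Build (set_type (torus R n)) (torus_point 0).

(** * Topology of the torus and its atlas of angle charts *)

Section torus_charts.
Context {R : realType} {n : nat}.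
Implicit Types p u : 'rV[R]_n.

Lemma continuous_cos_sin : continuous (@cos_sin R n).
Proof.
move=> u; apply: differentiable_continuous; apply: differentiable_pair;
  apply: differentiable_rV => j; under eq_fun do rewrite mxE.
- apply: (@differentiable_comp _ _ _ _ (fun w : 'rV[R]_n => w 0 j) cos).
    exact: differentiable_coord.
  exact/derivable1_diffP/derivable_cos.
- apply: (@differentiable_comp _ _ _ _ (fun w : 'rV[R]_n => w 0 j) sin).
    exact: differentiable_coord.
  exact/derivable1_diffP/derivable_sin.
Qed.

Lemma continuous_torus_point : continuous (@torus_point R n).
Proof. by apply: continuous_comp_initial; exact: continuous_cos_sin. Qed.

Lemma torus_compact : compact [set: torus R n].
Proof.
have boxC := @rV_compact R n (fun=> `[- pi, pi]%classic)
  (fun=> @segment_compact R _ _).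
rewrite (_ : [set: torus R n] =
    torus_point @` [set u : 'rV[R]_n | forall a, u 0 a \in `[- pi, pi]]).
  apply: continuous_compact boxC.
  exact/continuous_subspaceT/continuous_torus_point.
apply/seteqP; split => // z _; have [u ->] := torus_pointP z.
have /choice[v vP] a := principal_angle (u 0 a).
exists (\row_a v a) => [a|]; first by rewrite mxE; have [] := vP a.
by apply: val_inj; congr pair; apply/rowP => a; rewrite !mxE; have [] := vP a.
Qed.

Lemma torus_connected : connected [set: torus R n].
Proof.
(* The images of the segments from 0 to [u] cover the torus and all contain [torus_point 0]. *)
rewrite (_ : [set: torus R n] =
  \bigcup_(u in [set: 'rV[R]_n]) (torus_point \o *:%R^~ u) @` `[0, 1]).
  apply: bigcup_connected.
    exists (torus_point 0) => u _; exists 0; rewrite /= ?scale0r//.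
    by rewrite in_itv/= lexx ler01.
  move=> u _; apply: connected_continuous_connected.
    exact: segment_connected.
  apply: continuous_subspaceT => s.
  apply: continuous_comp; last exact: continuous_torus_point.
  exact: scalel_continuous.
apply/seteqP; split => // z _; have [u ->] := torus_pointP z.
by exists u => //; exists 1; rewrite /= ?scale1r// in_itv/= lexx ler01.
Qed.

Lemma torus_hausdorff : hausdorff_space (torus R n).
Proof.
apply: (@inj_hausdorff _ _ (set_val : torus R n -> _)).
- exact: initial_continuous.
- exact: val_inj.
- exact: norm_hausdorff.
Qed.

(** Cosine of the angle measured from [p 0 a], expanded by the addition formula so that it is
    defined and differentiable on the whole ambient space. [shifted_sin] is the matching sine. *)
Definition shifted_cos p (z : 'rV[R]_n * 'rV[R]_n) (a : 'I_n) : R :=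
  z.1 0 a * cos (p 0 a) + z.2 0 a * sin (p 0 a).

Definition shifted_sin p (z : 'rV[R]_n * 'rV[R]_n) (a : 'I_n) : R :=
  z.2 0 a * cos (p 0 a) - z.1 0 a * sin (p 0 a).

(** Charts are indexed by their centre [p]. The domain is a product of open half circles, and the
    corresponding target is the sup-norm ball of radius pi / 2, a cube. *)
Definition torus_dom p : set (torus R n) :=
  [set z | forall a, 0 < shifted_cos p (set_val z) a].

Definition torus_angle p (z : torus R n) : 'rV[R]_n :=
  \row_a (p 0 a + atan (shifted_sin p (set_val z) a /
                        shifted_cos p (set_val z) a)).

Lemma shifted_cosE p u a :
  shifted_cos p (set_val (torus_point u)) a = cos (u 0 a - p 0 a).
Proof. by rewrite /shifted_cos !mxE cosB. Qed.

Lemma shifted_sinE p u a :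
  shifted_sin p (set_val (torus_point u)) a = sin (u 0 a - p 0 a).
Proof. by rewrite /shifted_sin !mxE sinB. Qed.

Lemma torus_angleE p u a : torus_angle p (torus_point u) 0 a =
  p 0 a + atan (tan (u 0 a - p 0 a)).
Proof. by rewrite mxE shifted_cosE shifted_sinE. Qed.

Lemma torus_target_dist p u : ball p (pi / 2) u ->
  forall a, - (pi / 2) < u 0 a - p 0 a < pi / 2.
Proof.
by move=> [_ pu] a; rewrite -ltr_norml distrC; exact: pu.
Qed.

Lemma differentiable_shifted_cos p a z :
  differentiable (fun w => shifted_cos p w a) z.
Proof.
by apply: differentiableD; apply: differentiableM => //;
   [apply: (@differentiable_comp _ _ _ _ fst (fun u : 'rV[R]_n => u 0 a))|
    apply: (@differentiable_comp _ _ _ _ snd (fun u : 'rV[R]_n => u 0 a))];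
   exact: fst_differentiable || exact: snd_differentiable ||
   exact: differentiable_coord.
Qed.

Lemma differentiable_shifted_sin p a z :
  differentiable (fun w => shifted_sin p w a) z.
Proof.
by apply: differentiableB; apply: differentiableM => //;
   [apply: (@differentiable_comp _ _ _ _ snd (fun u : 'rV[R]_n => u 0 a))|
    apply: (@differentiable_comp _ _ _ _ fst (fun u : 'rV[R]_n => u 0 a))];
   exact: fst_differentiable || exact: snd_differentiable ||
   exact: differentiable_coord.
Qed.

Lemma torus_dom_open p : open (torus_dom p).
Proof.
rewrite openE => z pz.
suff: \forall w \near z, forall a, 0 < shifted_cos p (set_val w) a by [].
apply: (filter_forall (nbhs_filter z)) => a.
have : {for z, continuous ((fun w => shifted_cos p w a) \o
                           (set_val : torus R n -> _))}.
  apply: continuous_comp; first exact: initial_continuous.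
  exact/differentiable_continuous/differentiable_shifted_cos.
by move=> /cvgr_gt; apply; exact: pz.
Qed.

Lemma torus_angle_target p z :
  torus_dom p z -> ball p (pi / 2) (torus_angle p z).
Proof.
move=> pz; split=> [|i a]; first by rewrite divr_gt0 ?pi_gt0.
rewrite !ord1 /ball/= mxE opprD addrA subrr sub0r normrN.
by rewrite ltr_norml atan_gtNpi2 atan_ltpi2.
Qed.

Lemma torus_point_dom p u : ball p (pi / 2) u -> torus_dom p (torus_point u).
Proof.
move=> /torus_target_dist pu a; rewrite shifted_cosE.
exact: cos_gt0_pihalf.
Qed.

Lemma torus_angleK p z : torus_dom p z -> torus_point (torus_angle p z) = z.
Proof.
have [u ->] := torus_pointP z => pu.
have {}pu a : 0 < cos (u 0 a - p 0 a) by rewrite -shifted_cosE.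
apply: val_inj; congr pair; apply/rowP => a; rewrite !mxE.
  rewrite shifted_cosE shifted_sinE -/(tan _) cosD.
  rewrite cos_atan_tan// sin_atan_tan//.
  by rewrite -cosD addrCA subrr addr0.
rewrite shifted_cosE shifted_sinE -/(tan _) sinD cos_atan_tan// sin_atan_tan//.
by rewrite -sinD addrCA subrr addr0.
Qed.

Lemma torus_pointK p u : ball p (pi / 2) u -> torus_angle p (torus_point u) = u.
Proof.
move=> /torus_target_dist pu; apply/rowP => a.
by rewrite torus_angleE tanK ?in_itv/= ?pu// addrCA subrr addr0.
Qed.

Lemma torus_angle_continuous p :
  {within torus_dom p, continuous (torus_angle p)}.
Proof.
apply: continuous_in_subspaceT => z /set_mem pz.
(* The chart formula extended to the ambient space, where it is differentiable wherever every
   [shifted_cos] is positive. *)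
pose angle (w : 'rV[R]_n * 'rV[R]_n) : 'rV[R]_n :=
  \row_a (p 0 a + atan (shifted_sin p w a / shifted_cos p w a)).
apply: (@continuous_comp _ _ _ set_val angle); first exact: initial_continuous.
apply/differentiable_continuous/differentiable_rV => a.
under eq_fun do rewrite mxE.
apply: differentiableD => //.
apply: (@differentiable_comp _ _ _ _ _ atan); last first.
  exact/derivable1_diffP/derivable_atan.
apply: differentiableM; first exact: differentiable_shifted_sin.
apply: differentiableV; first exact: differentiable_shifted_cos.
by rewrite gt_eqF.
Qed.

Lemma torus_cover z : exists p, torus_dom p z.
Proof.
have [u ->] := torus_pointP z; exists u => a.
by rewrite shifted_cosE subrr cos0.
Qed.

(** Transition maps are locally translations: coordinate [a] depends on [u 0 a] alone, with
    derivative 1, so its directional derivatives are constants. *)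
Lemma torus_transition_smooth p q :
  smooth_on (ball p (pi / 2) `&` torus_point @^-1` torus_dom q)
    (torus_angle q \o torus_point).
Proof.
pose shift_angle a (x : R) := q 0 a + atan (tan (x - q 0 a)).
have shift_angleP a x : 0 < cos (x - q 0 a) -> is_derive x 1 (shift_angle a) 1.
  move=> cx; have cx0 : cos (x - q 0 a) != 0 by rewrite gt_eqF.
  have ds : is_derive x 1 (fun y => y - q 0 a) 1.
    by apply: is_derive_eq; rewrite subr0.
  have dt := @is_derive1_comp R tan (fun y => y - q 0 a) x _ _
    (is_derive_tan cx0) ds.
  have da := @is_derive1_comp R atan _ x _ _ (is_derive1_atan _) dt.
  apply: is_derive_eq (is_deriveD (is_derive_cst (q 0 a) x 1) da) _.
  (* The derivative 1 / (1 + tan^2) of [atan] cancels the derivative 1 / cos^2 of [tan]. *)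
  by rewrite add0r mulr1 /= -cos2_tan2// mulVf// invr_eq0 expf_neq0.
pose e a (u : 'rV[R]_n) := (shift_angle a \o (fun w : 'rV[R]_n => w 0 a)) u.
have eP a u v : torus_dom q (torus_point u) ->
    differentiable (e a) u /\ 'D_v (e a) u = v 0 a.
  move=> /(_ a); rewrite shifted_cosE => /shift_angleP.
  move=> /(derive_comp _ _ (fun w : 'rV[R]_n => w 0 a) u v).
  by rewrite derive_coord mul1r; apply; exact: differentiable_coord.
apply: (smooth_on_generated_algebra _ e) => [a u [_ qu]|a v||a].
- by have [] := eP a u 0 qu.
- exists (fun=> v 0 a); first exact: GenCst.
  by move=> u /set_mem[_ qu]; have [_ ->] := eP a u v qu.
- apply: openI; first exact: ball_open.
  apply: open_comp => [u _|]; first exact: continuous_torus_point.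
  exact: torus_dom_open.
- under eq_fun do rewrite /= torus_angleE.
  exact: GenVar.
Qed.

End torus_charts.

Definition torus_manifold (R : realType) (n : nat) : smooth_manifold R n :=
  @SmoothManifold R n (torus R n) 'rV[R]_n torus_dom (fun p => ball p (pi / 2))
    torus_angle (fun=> torus_point) torus_hausdorff
    (compact_second_countable torus_compact)
    torus_cover torus_dom_open (fun p => ball_open p (pi / 2))
    torus_angle_target torus_point_dom
    torus_angleK torus_pointK torus_angle_continuous
    (fun p => continuous_subspaceT continuous_torus_point)
    torus_transition_smooth.

(** * The amplitudes *)

(** The mean value theorem makes [f] injective, and the inverse function rule gives the derivative.
    Nothing is claimed about [g] off the range of [f], where [get] returns an arbitrary value. *)
Lemma inverse_of_increasing {R : realType} (f df : R -> R) :
    (forall x : R, is_derive x 1 f (df x)) -> (forall x, 0 < df x) ->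
  exists g, forall x, g (f x) = x /\ is_derive (f x) 1 g (df x)^-1.
Proof.
move=> fdf df0.
have fcont x : {for x, continuous f}.
  exact/differentiable_continuous/derivable1_diffP/ex_derive.
have f_lt x y : x < y -> f x < f y.
  move=> xy; have [|c _ fxy] := @MVT R f df x y xy (fun z _ => fdf z).
    exact: continuous_subspaceT.
  by rewrite -subr_gt0 fxy mulr_gt0// subr_gt0.
have finj : injective f.
  by move=> x y fxy; case: (ltgtP x y) => // /f_lt; rewrite fxy ltxx.
pose g y := get [set x | f x = y].
have fK : cancel f g.
  by move=> x; apply: finj; apply: (@getPex _ [set z | f z = f x]); exists x.
exists g => x; split => //.
apply: is_derive_inverse; [near=> z; exact: fK|near=> z; exact: fcont|
  by rewrite gt_eqF].
Unshelve. all: by end_near. Qed.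

(** The equation is autonomous, tau' = 1 / df(tau), so tau is the inverse of a primitive [f] of
    [df]. The index [j0] makes [df] positive and makes [f] reach every negative value. *)
Lemma exponential_sum_flow {R : realType} (m : nat) (P : pred 'I_m)
    (j0 : 'I_m) : P j0 ->
  exists tau : R -> R, forall t : R, t < 0 -> is_derive t 1 tau
    (\sum_(j < m) (P j)%:R *
       (j.+1%:R * expR (- (j.+1%:R ^+ 2) * tau t)) ^+ 2)^-1.
Proof.
move=> Pj0.
pose k (j : 'I_m) : R := j.+1%:R.
pose f (x : R) := \sum_(j < m) - ((P j)%:R / 2 * expR (- (2 * k j ^+ 2) * x)).
pose df (x : R) := \sum_(j < m) (P j)%:R * (k j * expR (- (k j ^+ 2) * x)) ^+ 2.
have fdf (x : R) : is_derive x 1 f (df x).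
  rewrite /f -fct_sumE; apply: is_derive_sum => j.
  pose lin := ( *:%R (- (2 * k j ^+ 2)) : R -> R).
  have dlin : is_derive x 1 lin (- (2 * k j ^+ 2)).
    by apply: is_derive_eq; rewrite scaler1.
  have dE := @is_derive1_comp R expR lin x _ _ (is_derive_expR _) dlin.
  have := is_deriveN (is_deriveZ ((P j)%:R / 2) dE).
  move=> /is_derive_eq; apply.
  have -> : lin x = - k j ^+ 2 * x + - k j ^+ 2 * x.
    by rewrite /lin /GRing.scale/=; ring.
  by rewrite expRD /GRing.scale/=; field.
have df0 x : 0 < df x.
  rewrite /df (bigD1 j0)//= ltr_pwDl//.
    by rewrite Pj0 mul1r exprn_gt0// mulr_gt0 ?expR_gt0.
  by apply: sumr_ge0 => j _; rewrite mulr_ge0// sqr_ge0.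
have fsurj (t : R) : t < 0 -> exists x, f x = t.
  (* Bounds for the intermediate value theorem, both from exp(y) >= 1 + y. At [a] the term of [j0]
     alone is -exp(-2t)/2 <= t - 1/2; at [b] every term is at least -1/(4b) = t/m. *)
  move=> t0; pose a := t / k j0 ^+ 2; pose b := m%:R / (- (4 * t)).
  have k0 j : 0 < k j by rewrite ltr0n.
  have m0 : 0 < m%:R :> R by rewrite ltr0n (leq_ltn_trans _ (ltn_ord j0)).
  have b0 : 0 < b by rewrite divr_gt0// oppr_gt0 pmulr_rlt0.
  have a0 : a < 0 by rewrite pmulr_llt0 ?invr_gt0 ?exprn_gt0.
  have ab : a <= b by rewrite ltW// (lt_trans a0).
  have fa : f a <= t.
    rewrite /f (bigD1 j0)//= Pj0 -[leRHS]addr0 lerD//.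
      have := expR_ge1Dx (- (2 * k j0 ^+ 2) * a).
      have -> : - (2 * k j0 ^+ 2) * a = - 2 * t.
        by rewrite /a; field; rewrite gt_eqF.
      by rewrite mulr1n; set E := expR _ => ?; lra.
    by apply: sumr_le0 => j _; rewrite oppr_le0 !mulr_ge0// expR_ge0.
  have fb : t <= f b.
    have -> : t = \sum_(j < m) t / m%:R.
      by rewrite sumr_const card_ord -[RHS]mulr_natr mulfVK// gt_eqF.
    apply: ler_sum => j _; rewrite lerNr.
    have -> : - (t / m%:R) = (2 * b)^-1 / 2.
      by rewrite /b; field; rewrite lt_eqF//= gt_eqF.
    set E := expR _; have E0 : 0 < E by exact: expR_gt0.
    have bE : E <= (2 * b)^-1.
      rewrite /E mulNr expRN lef_pV2 ?posrE ?expR_gt0 ?(mulr_gt0 _ b0)//.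
      apply: le_trans (expR_ge1Dx _).
      have : 1 <= k j ^+ 2 by rewrite -natrX ler1n expn_gt0.
      by move=> ?; nra.
    move: bE; set B := (2 * b)^-1 => bE.
    by case: (P j); rewrite ?mulr1n ?mulr0n; lra.
  have [||x _ fx] := @IVT R f a b t ab; last by exists x.
    apply: continuous_subspaceT => x.
    exact/differentiable_continuous/derivable1_diffP/ex_derive.
  by rewrite ge_min fa le_max fb orbT.
have [g gP] := inverse_of_increasing _ _ fdf df0.
by exists g => t /fsurj[x <-]; have [gx] := gP x; rewrite gx.
Qed.

(** * The flow *)

(** Groups the 2m real coordinates into m complex ones, so that cosine and sine terms can be
    combined. *)
Lemma sum_ord_double {R : nmodType} (m : nat) (f : nat -> bool -> R) :
  \sum_(i < 2 * m) f i./2 (odd i) = \sum_(j < m) (f j false + f j true).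
Proof.
rewrite mul2n; elim: m => [|m IHm]; first by rewrite !big_ord0.
rewrite doubleS !big_ord_recr/= IHm addrA uphalf_double odd_double/=.
by rewrite doubleK.
Qed.

(** The boolean is the parity of a real coordinate: even for real parts, odd for imaginary parts. *)
Definition wave {R : realType} (b : bool) (x : R) : R :=
  if b then sin x else cos x.

Definition dwave {R : realType} (b : bool) (x : R) : R :=
  if b then cos x else - sin x.

Lemma is_derive_wave {R : realType} b (x : R) :
  is_derive x 1 (wave b) (dwave b x).
Proof. by case: b; [exact: is_derive_sin|exact: is_derive_cos]. Qed.

Lemma is_derive_dwave {R : realType} b (x : R) :
  is_derive x 1 (dwave b) (- wave b x).
Proof. by case: b; [exact: is_derive_cos|exact: is_deriveN]. Qed.

(** By the addition formulas, cos(kx) and sin(kx) are polynomials in cos x and sin x. Hence the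
    position depends only on the point of the torus. *)
Lemma wave_periodic {R : realType} (x y : R) :
  cos x = cos y -> sin x = sin y ->
  forall b k, wave b (k%:R * x) = wave b (k%:R * y).
Proof.
move=> cxy sxy b k; move: b; elim: k => [|k IHk] b; first by rewrite !mul0r.
have ck := IHk false; have sk := IHk true; rewrite /wave in ck sk.
rewrite -natr1 !mulrDl !mul1r; case: b => /=.
  by rewrite !sinD ck sk cxy sxy.
by rewrite !cosD ck sk cxy sxy.
Qed.

Section flow.
Context {R : realType} {n : nat}.
Variables (m : nat) (cls : nat -> 'I_n) (tau : 'I_n -> R -> R).

Definition amplitude (j : nat) (t : R) : R :=
  expR (- (j.+1%:R ^+ 2) * tau (cls j) t).

(** The squared length of the [a]-th coordinate tangent vector, that is, the metric entry D_a. *)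
Definition speed2 (a : 'I_n) (t : R) : R :=
  \sum_(j < m) (cls j == a)%:R * (j.+1%:R * amplitude j t) ^+ 2.

(* Coordinates 2j and 2j + 1 are the real and imaginary parts of
   r_j exp(i (j + 1) u_(cls j)). *)
Definition position (t : R) (u : 'rV[R]_n) : 'rV[R]_(2 * m) :=
  \row_i (amplitude i./2 t * wave (odd i) ((i./2).+1%:R * u 0 (cls i./2))).

Hypothesis speed2_gt0 : forall a t, 0 < speed2 a t.
Hypothesis tauP : forall a (t : R), t < 0 ->
  is_derive t 1 (tau a) (speed2 a t)^-1.

Definition dposition (t : R) (u : 'rV[R]_n) (a : 'I_n) : 'rV[R]_(2 * m) :=
  \row_i ((cls i./2 == a)%:R * ((i./2).+1%:R * amplitude i./2 t *
      dwave (odd i) ((i./2).+1%:R * u 0 (cls i./2)))).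

Definition ddposition (t : R) (u : 'rV[R]_n) (a : 'I_n) : 'rV[R]_(2 * m) :=
  \row_i ((cls i./2 == a)%:R * (- ((i./2).+1%:R ^+ 2) * amplitude i./2 t *
      wave (odd i) ((i./2).+1%:R * u 0 (cls i./2)))).

Lemma derive_angular (f : R -> R) (l k : R) (a : 'I_n) (u v : 'rV[R]_n) :
  is_derive (k * u 0 a) 1 f l ->
  differentiable (fun w : 'rV[R]_n => f (k * w 0 a)) u /\
  'D_v (fun w : 'rV[R]_n => f (k * w 0 a)) u = l * (k * v 0 a).
Proof.
move=> fl.
have dk : differentiable (fun w : 'rV[R]_n => k * w 0 a) u.
  by apply: differentiableM => //; exact: differentiable_coord.
have [df ->] := derive_comp _ _ (fun w : 'rV[R]_n => k * w 0 a) u v fl dk.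
split=> //; congr (_ * _).
rewrite deriveMl ?derive_coord//.
exact/diff_derivable/differentiable_coord.
Qed.

Lemma derive_position t u a :
  differentiable (position t) u /\
  'D_(delta_mx 0 a) (position t) u = dposition t u a.
Proof.
have comp i : differentiable (fun w => position t w 0 i) u /\
    'D_(delta_mx 0 a) (fun w => position t w 0 i) u = dposition t u a 0 i.
  under eq_fun do rewrite mxE.
  have [dw Dw] := derive_angular _ _ (i./2).+1%:R (cls i./2) u (delta_mx 0 a)
    (is_derive_wave (odd i) _).
  split; first by apply: differentiableM.
  rewrite deriveMl; last exact: diff_derivable.
  by rewrite Dw !mxE eqxx/=; ring.
have dF : differentiable (position t) u.
  by apply: differentiable_rV => i; have [] := comp i.
by split=> //; apply/rowP => i; rewrite derive_rV//; have [] := comp i.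
Qed.

(** Each coordinate of the position depends on one angle only, so mixed second derivatives
    vanish. *)
Lemma derive_dposition t u a b :
  'D_(delta_mx 0 a) (dposition t ^~ b) u = (a == b)%:R *: ddposition t u a.
Proof.
have comp i : differentiable (fun w => dposition t w b 0 i) u /\
    'D_(delta_mx 0 a) (fun w => dposition t w b 0 i) u =
    ((a == b)%:R *: ddposition t u a) 0 i.
  under eq_fun do rewrite mxE !mulrA.
  have [dw Dw] := derive_angular _ _ (i./2).+1%:R (cls i./2) u (delta_mx 0 a)
    (is_derive_dwave (odd i) _).
  split; first by apply: differentiableM.
  rewrite deriveMl; last exact: diff_derivable.
  rewrite Dw !mxE eqxx/=.
  have [->|ab] := eqVneq a b; first by case: (_ == b) => /=; ring.
  have [->|_] := eqVneq (cls i./2) b; last by ring.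
  by rewrite [b == a]eq_sym (negbTE ab)/=; ring.
have dF : differentiable (dposition t ^~ b) u.
  by apply: differentiable_rV => i; have [] := comp i.
by apply/rowP => i; rewrite derive_rV//; have [] := comp i.
Qed.

(** * Induced metric and mean curvature of the embedded torus *)

Lemma jacobian_position t u : 'J (position t) u = \matrix_a dposition t u a.
Proof.
apply/row_matrixP => a; rewrite rowK rowE -deriveEjacobian.
  by have [] := derive_position t u a.
by have [] := derive_position t u a.
Qed.

(** Off the diagonal, no coordinate varies with both angles. On it, cos^2 + sin^2 = 1 within each
    pair of coordinates removes [u]. *)
Lemma induced_metric_position t u :
  induced_metric (position t) u = diag_mx (\row_a speed2 a t).
Proof.
rewrite /induced_metric jacobian_position; apply/matrixP => a b; rewrite !mxE.
pose f j (c : bool) := (cls j == a)%:R * (cls j == b)%:R *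
  (j.+1%:R * amplitude j t * dwave c (j.+1%:R * u 0 (cls j))) ^+ 2.
rewrite (eq_bigr (fun i : 'I_(2 * m) => f i./2 (odd i))); last first.
  by move=> i _; rewrite !mxE /f; ring.
rewrite sum_ord_double /speed2 -sumrMnl; apply: eq_bigr => j _.
rewrite /f /=.
have := cos2Dsin2 (j.+1%:R * u 0 (cls j)).
set c := cos _; set s := sin _ => cs1.
transitivity ((cls j == a)%:R * (cls j == b)%:R *
  (j.+1%:R * amplitude j t) ^+ 2 * (c ^+ 2 + s ^+ 2)); first by ring.
rewrite cs1 mulr1.
have [->|_] := eqVneq (cls j) a; last by rewrite mulr0n !mul0r mul0rn.
by rewrite !mul1r mulr_natl.
Qed.

Lemma invmx_induced_metric t u :
  invmx (induced_metric (position t) u) = diag_mx (\row_a (speed2 a t)^-1).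
Proof.
have gK : induced_metric (position t) u *m
    diag_mx (\row_a (speed2 a t)^-1) = 1%:M.
  rewrite induced_metric_position mulmx_diag -diag_const_mx; congr diag_mx.
  by apply/rowP => a; rewrite !mxE mulfV// gt_eqF.
have [gU _] := mulmx1_unit gK.
by rewrite -[LHS]mulmx1 -gK mulKmx.
Qed.

(** The Jacobian has at least the rank of its Gram matrix, which is diagonal with positive
    entries. *)
Lemma position_row_free t u : row_free ('J (position t) u).
Proof.
have gU : induced_metric (position t) u \in unitmx.
  rewrite induced_metric_position unitmxE det_diag unitfE prodf_seq_neq0.
  by apply/allP => a _; rewrite mxE gt_eqF.
rewrite /row_free eqn_leq rank_leq_row/=.
by apply: leq_trans (mxrankM_maxl _ ('J (position t) u)^T); rewrite mxrank_unit.
Qed.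

(** In each complex coordinate the second derivative is radial and the first is its quarter turn, so
    the two products cancel. *)
Lemma ddposition_normal t u a : ddposition t u a *m ('J (position t) u)^T = 0.
Proof.
rewrite jacobian_position; apply/rowP => b; rewrite !mxE.
pose f j (c : bool) := - ((cls j == a)%:R * (cls j == b)%:R *
  j.+1%:R ^+ 3 * amplitude j t ^+ 2 * wave c (j.+1%:R * u 0 (cls j)) *
  dwave c (j.+1%:R * u 0 (cls j))).
rewrite (eq_bigr (fun i : 'I_(2 * m) => f i./2 (odd i))); last first.
  by move=> i _; rewrite !mxE /f; ring.
by rewrite sum_ord_double big1// => j _; rewrite /f/=; ring.
Qed.

(** The inverse metric leaves only the terms a = b, and there the second derivative is already
    normal, so the projection removes nothing. *)
Lemma mean_curvature_position t u :
  - mean_curvature (position t) u = \sum_a (speed2 a t)^-1 *: ddposition t u a.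
Proof.
rewrite /mean_curvature opprK; apply: eq_bigr => a _.
rewrite (bigD1 a)//= big1 ?addr0 => [|b ab].
  rewrite invmx_induced_metric !mxE eqxx mulr1n; congr (_ *: _).
  rewrite /second_fundamental_form.
  have -> : 'D_(delta_mx 0 a) (position t) = dposition t ^~ a.
    by apply/funext => w; have [] := derive_position t w a.
  rewrite derive_dposition eqxx scale1r mulmxBr mulmx1 /tangent_proj !mulmxA.
  by rewrite ddposition_normal !mul0mx subr0.
by rewrite invmx_induced_metric !mxE eq_sym (negbTE ab) mulr0n scale0r.
Qed.

Lemma is_derive_amplitude j (t : R) : t < 0 ->
  is_derive t 1 (amplitude j)
    (- (j.+1%:R ^+ 2) * amplitude j t * (speed2 (cls j) t)^-1).
Proof.
move=> t0; have dtau := tauP (cls j) t t0.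
have dlin := is_deriveZ (- (j.+1%:R ^+ 2)) dtau.
have := @is_derive1_comp R expR _ t _ _ (is_derive_expR _) dlin.
by move=> /is_derive_eq; apply; rewrite /amplitude /GRing.scale/=; ring.
Qed.

(** In coordinate [i] only the summand [a = cls i./2] of the curvature is nonzero, and it equals the
    time derivative of the amplitude times the wave. *)
Lemma derive_position_time (t : R) u : t < 0 ->
  derive1 (position ^~ u) t = - mean_curvature (position t) u.
Proof.
move=> t0; rewrite mean_curvature_position derive1E.
have comp i : is_derive t 1 (fun s => position s u 0 i)
    ((speed2 (cls i./2) t)^-1 * ddposition t u (cls i./2) 0 i).
  under eq_fun do rewrite mxE.
  have := is_deriveM (is_derive_amplitude i./2 t t0)
    (is_derive_cst (wave (odd i) ((i./2).+1%:R * u 0 (cls i./2))) t 1).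
  by move=> /is_derive_eq; apply;
    rewrite !mxE eqxx scaler0 add0r /GRing.scale/=; ring.
have dF : derivable (position ^~ u) t 1.
  by apply/derivable_mxP => i j; rewrite ord1; have [] := comp j.
apply/rowP => i; rewrite derive_mx// mxE summxE.
have [_ ->] := comp i.
rewrite (bigD1 (cls i./2))//= big1 ?addr0 => [|a ai]; first by rewrite [RHS]mxE.
by rewrite !mxE [_ == a]eq_sym (negbTE ai) mul0r mulr0.
Qed.

(** Generators of an algebra closed under derivation in time and space. Reciprocals of [speed2] are
    included because the derivative of an amplitude contains one. *)
Definition angular_function (i : (nat + 'I_n) + (bool * nat * 'I_n))
    (z : R * 'rV[R]_n) : R :=
  match i with
  | inl (inl j) => amplitude j z.1
  | inl (inr a) => (speed2 a z.1)^-1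
  | inr (b, k, a) => wave b (k%:R * z.2 0 a)
  end.

(** The square is written as a product so that the formula is visibly built from the generators by
    [GenMul]. *)
Lemma is_derive_speed2 a (t : R) : t < 0 -> is_derive t 1 (speed2 a)
  (\sum_(j < m) (cls j == a)%:R * (- 2 * j.+1%:R ^+ 4 *
     (amplitude j t * amplitude j t) * (speed2 (cls j) t)^-1)).
Proof.
move=> t0.
rewrite [X in is_derive _ _ X](_ : _ = \sum_(j < m) fun s =>
    (cls j == a)%:R * (j.+1%:R * amplitude j s) ^+ 2); last first.
  by apply/funext => s; rewrite fct_sumE.
apply: is_derive_sum => j.
have dr := is_derive_amplitude j t t0.
have := is_deriveZ (cls j == a)%:R (is_deriveX 2 (is_deriveZ j.+1%:R dr)).
move=> /is_derive_eq; apply; rewrite /GRing.scale/=.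
rewrite -[_ *: _]/(j.+1%:R * amplitude j t); ring.
Qed.

Lemma smooth_position (U : set 'rV[R]_n) : open U ->
  smooth_on ([set t : R | t < 0] `*` U)
    (fun z : R * 'rV[R]_n => position z.1 z.2).
Proof.
move=> Uopen.
have time (f : R -> R) (l : R) (z v : R * 'rV[R]_n) : is_derive z.1 1 f l ->
    differentiable (fun w : R * 'rV[R]_n => f w.1) z /\
    'D_v (fun w : R * 'rV[R]_n => f w.1) z = l * v.1.
  move=> fl; rewrite -(@derive_fst R R 'rV[R]_n z v).
  exact: derive_comp fl (fst_differentiable z).
have space (f : R -> R) (l k : R) (a : 'I_n) (z v : R * 'rV[R]_n) :
    is_derive (k * z.2 0 a) 1 f l ->
    differentiable (fun w : R * 'rV[R]_n => f (k * w.2 0 a)) z /\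
    'D_v (fun w : R * 'rV[R]_n => f (k * w.2 0 a)) z = l * (k * v.2 0 a).
  move=> fl.
  have [dc Dc] : differentiable (fun w : R * 'rV[R]_n => w.2 0 a) z /\
      'D_v (fun w : R * 'rV[R]_n => w.2 0 a) z = v.2 0 a.
    have dcoord : differentiable (fun w : 'rV[R]_n => w 0 a) z.2.
      exact: differentiable_coord.
    have dsnd := @snd_differentiable R R 'rV[R]_n z.
    have dc := differentiable_comp dsnd dcoord; split=> //.
    transitivity ('D_v ((fun w : 'rV[R]_n => w 0 a) \o snd) z) => //.
    rewrite deriveE// diff_comp//= -deriveE// derive_coord diff_lin// => w.
    exact: cvg_snd.
  have dk : differentiable (fun w : R * 'rV[R]_n => k * w.2 0 a) z.
    exact: differentiableM.
  have [df ->] := derive_comp _ _ (fun w : R * 'rV[R]_n => k * w.2 0 a)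
    z v fl dk.
  by split=> //; rewrite deriveMl ?Dc//; exact: diff_derivable.
have amplitudeP j (z v : R * 'rV[R]_n) : z.1 < 0 ->
    differentiable (angular_function (inl (inl j))) z /\
    'D_v (angular_function (inl (inl j))) z =
    - (j.+1%:R ^+ 2) * amplitude j z.1 * (speed2 (cls j) z.1)^-1 * v.1.
  move=> z0.
  exact: (time (amplitude j) _ z v (is_derive_amplitude j z.1 z0)).
have speedP a (z v : R * 'rV[R]_n) : z.1 < 0 ->
    differentiable (angular_function (inl (inr a))) z /\
    'D_v (angular_function (inl (inr a))) z =
    - 1 * ((speed2 a z.1)^-1 * (speed2 a z.1)^-1) *
    (\sum_(j < m) (cls j == a)%:R * (- 2 * j.+1%:R ^+ 4 *
      (amplitude j z.1 * amplitude j z.1) * (speed2 (cls j) z.1)^-1)) * v.1.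
  move=> z0; apply: (time (fun s => (speed2 a s)^-1)); rewrite mulN1r -invfM.
  by apply: is_deriveV; [rewrite gt_eqF|exact: is_derive_speed2].
have waveP b k a (z v : R * 'rV[R]_n) :
    differentiable (angular_function (inr (b, k, a))) z /\
    'D_v (angular_function (inr (b, k, a))) z =
    dwave b (k%:R * z.2 0 a) * (k%:R * v.2 0 a).
  exact: (space (wave b) _ k%:R a z v (is_derive_wave _ _)).
apply: (smooth_on_generated_algebra _ angular_function).
- move=> [[j|a]|[[b k] a]] z [z0 _].
  + by have [] := amplitudeP j z 0 z0.
  + by have [] := speedP a z 0 z0.
  + by have [] := waveP b k a z 0.
- have gr j : generated_algebra angular_function
      (fun z : R * 'rV[R]_n => amplitude j z.1).
    exact: (GenVar _ (inl (inl j))).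
  have gs a : generated_algebra angular_function
      (fun z : R * 'rV[R]_n => (speed2 a z.1)^-1).
    exact: (GenVar _ (inl (inr a))).
  have gw b k a : generated_algebra angular_function
      (fun z : R * 'rV[R]_n => wave b (k%:R * z.2 0 a)).
    exact: (GenVar _ (inr (b, k, a))).
  (* The witnesses are the derivative formulas just proved, filled in by unification. *)
  move=> [[j|a]|[[b k] a]] v.
  + eexists; last first.
      by move=> z /set_mem[z0 _]; have [_ ->] := amplitudeP j z v z0.
    by do ?[exact: GenCst|exact: gr|exact: gs|apply: GenMul].
  + eexists; last by move=> z /set_mem[z0 _]; have [_ ->] := speedP a z v z0.
    apply: GenMul; last exact: GenCst.
    apply: GenMul; first by do ?[exact: GenCst|exact: gs|apply: GenMul].
    apply: generated_algebra_sum => j _.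
    by do ?[exact: GenCst|exact: gr|exact: gs|apply: GenMul].
  + eexists; last by move=> z _; have [_ ->] := waveP b k a z v.
    apply: GenMul; last exact: GenCst.
    (* Up to sign, [dwave] is the wave of the other parity. *)
    case: b => /=; first exact: gw false k a.
    rewrite (_ : (fun _ => _) =
        fun z : R * 'rV[R]_n => -1 * wave true (k%:R * z.2 0 a)).
      by apply: GenMul; [exact: GenCst|exact: gw].
    by apply/funext => z; rewrite mulN1r.
- rewrite openE => z [z0 Uz]; exists ([set t : R | t < 0], U) => //.
  by split; apply: open_nbhs_nbhs; split => //; exact: open_lt.
- move=> i; under eq_fun do rewrite mxE.
  apply: GenMul; first exact: (GenVar _ (inl (inl i./2))).
  exact: (GenVar _ (inr (odd i, (i./2).+1, cls i./2))).
Qed.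

End flow.

(** * Fullness *)

(* With h = pi / (m + 1), the operator f |-> f(s + h) + f(s - h) + 2 f(s)
   multiplies the frequency j + 1 by 2 (cos((j + 1) h) + 1), which is 0 exactly
   for the top frequency m + 1. *)
Lemma trigonometric_independence {R : realType} (m : nat) (A B : nat -> R)
    (C : R) :
    (forall s, \sum_(j < m)
       (A j * cos (j.+1%:R * s) + B j * sin (j.+1%:R * s)) = C) ->
  forall j, (j < m)%N -> A j = 0 /\ B j = 0.
Proof.
elim: m A B C => // m IHm A B C ABC.
pose h : R := pi / m.+1%:R.
have m0 : m.+1%:R != 0 :> R by rewrite pnatr_eq0.
have hm : m.+1%:R * h = pi by rewrite mulrC divfK.
pose c j := 2 * (cos (j.+1%:R * h) + 1).
have c0 j : (j < m)%N -> c j != 0.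
  move=> jm; rewrite mulf_neq0//.
  (* Below the top frequency the angle stays in [0, pi[, where the cosine exceeds -1. *)
  have /andP[jh0 jh] : 0 <= j.+1%:R * h < pi.
    rewrite mulr_ge0// ?divr_ge0 ?pi_ge0//= -hm ltr_pM2r ?ltr_nat//.
    by rewrite divr_gt0 ?pi_gt0.
  have : cos pi < cos (j.+1%:R * h).
    by rewrite ltr_cos ?in_itv/= ?lexx ?pi_ge0 ?andbT// jh0 ltW.
  by rewrite cospi => ?; rewrite gt_eqF//; lra.
have lower j : (j < m)%N -> A j = 0 /\ B j = 0.
  move=> jm.
  suff /(_ _ jm) : forall j, (j < m)%N -> c j * A j = 0 /\ c j * B j = 0.
    move=> [/eqP + /eqP]; rewrite ![c j * _ == _]mulf_eq0 (negbTE (c0 _ jm)).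
    by move=> /eqP ? /eqP.
  (* The operator turns the constant [C] into 4 C and kills the last term, leaving a relation of
     length [m]. *)
  apply: (IHm _ _ (4 * C)) => s.
  pose T i x := A i * cos (i.+1%:R * x) + B i * sin (i.+1%:R * x).
  have TP i : c i * T i s = T i (s + h) + T i (s - h) + 2 * T i s.
    rewrite /T /c.
    rewrite [_ * (s + h)]mulrDr [_ * (s - h)]mulrBr cosD cosB sinD sinB.
    by ring.
  have : \sum_(i < m.+1) c i * T i s = 4 * C.
    under eq_bigr do rewrite TP.
    by rewrite 2!big_split -mulr_sumr /T/= !ABC; ring.
  rewrite big_ord_recr/= {2}/c hm cospi addNr mulr0 mul0r addr0 => <-.
  by apply: eq_bigr => i _; rewrite /T; ring.
have top s : A m * cos (m.+1%:R * s) + B m * sin (m.+1%:R * s) = C.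
  rewrite -(ABC s) big_ord_recr/= big1 ?add0r// => j _.
  by have [-> ->] := lower _ (ltn_ord j); rewrite !mul0r addr0.
(* The values at 0, h and h / 2 give A = C, -A = C and B = C. *)
have := top 0; have := top h; have := top (h / 2).
rewrite mulrA hm mulr0 cos0 sin0 cospi sinpi cos_pihalf sin_pihalf => T1 T2 T3.
move=> j; rewrite ltnS leq_eqVlt => /orP[/eqP ->|/lower//].
by split; lra.
Qed.

(** Project onto a complement of [V] along [V], then take a coordinate that is nonzero on some
    vector of the complement. *)
Lemma proper_subspace_functional {K : fieldType} {n : nat}
    (V : {vspace 'rV[K]_n}) : (\dim V < n)%N ->
  exists w : 'I_n -> K, (exists i, w i != 0) /\
    (forall v, v \in V -> \sum_i v 0 i * w i = 0).
Proof.
move=> Vn.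
have [W [x xW x0] [WV0 VW0]] : exists2 W : {vspace 'rV[K]_n},
    exists2 x, x \in W & x != 0 & (W :&: V = 0)%VS /\ (V :&: W = 0)%VS.
  exists V^C%VS; last by rewrite capvC capv_compl.
  exists (vpick V^C); first exact: memv_pick.
  rewrite vpick0 -dimv_eq0 dimv_compl dimvf dim_matrix mul1r.
  by rewrite subn_eq0 -ltnNge.
pose f := daddv_pi W V.
have fV (v : 'rV[K]_n) : v \in V -> f v = 0.
  move=> Vv.
  have := daddv_pi_add WV0 (subvP (addvSr _ _) _ Vv).
  rewrite (daddv_pi_id VW0 Vv).
  by move/(canRL (addrK _)); rewrite subrr.
have fx : f x = x by exact: daddv_pi_id.
have [i xi] : exists i, x 0 i != 0.
  apply/existsP; apply: contraNT x0 => /existsPn x0.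
  by apply/eqP/rowP => i; rewrite mxE; apply/eqP/negPn.
have fE (v : 'rV[K]_n) : \sum_j v 0 j * f (delta_mx 0 j) 0 i = f v 0 i.
  rewrite {2}[v]row_sum_delta linear_sum summxE.
  by apply: eq_bigr => j _; rewrite linearZ mxE.
exists (fun j => f (delta_mx 0 j) 0 i); split.
  apply/existsP; apply: contraNT xi => /existsPn w0.
  rewrite -fx -fE big1// => j _.
  by have /negPn/eqP -> := w0 j; rewrite mulr0.
by move=> v Vv; rewrite fE fV// mxE.
Qed.

(** A nonzero functional constant on the image gives a trigonometric relation whose coefficients
    must all vanish; amplitudes being positive, so must the functional. *)
Lemma position_full {R : realType} {n : nat} (m : nat) (cls : nat -> 'I_n)
    (tau : 'I_n -> R -> R) (t : R) (p : 'rV[R]_(2 * m))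
    (V : {vspace 'rV[R]_(2 * m)}) :
  (\dim V < 2 * m)%N ->
  ~ (forall u, affine_subspace p V (position m cls tau t u)).
Proof.
move=> /proper_subspace_functional[w [[i wi] wV]] Vpos.
(* [w] reindexed by frequency and parity, with value 0 out of range. *)
pose c (j : nat) (b : bool) : R := oapp w 0 (insub (b + j.*2)%N).
have cE (k : 'I_(2 * m)) : c k./2 (odd k) = w k.
  by rewrite /c odd_double_half valK.
have key s : \sum_(j < m)
    (amplitude cls tau j t * c j false * cos (j.+1%:R * s) +
     amplitude cls tau j t * c j true * sin (j.+1%:R * s)) = \sum_k p 0 k * w k.
  (* With all angles equal to [s], the frequencies are distinct whatever [cls] is. *)
  have /wV := Vpos (const_mx s).
  under eq_bigr do rewrite !mxE mulrBl.
  rewrite big_split/= sumrN => /eqP; rewrite subr_eq0 => /eqP <-.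
  pose f j b := amplitude cls tau j t * c j b * wave b (j.+1%:R * s).
  rewrite -(sum_ord_double m f); apply: eq_bigr => k _.
  by rewrite /f cE; ring.
have im : (i./2 < m)%N by rewrite ltn_half_double -mul2n.
have [c1 c2] := trigonometric_independence m
  (fun j => amplitude cls tau j t * c j false)
  (fun j => amplitude cls tau j t * c j true) _ key i./2 im.
move/eqP: wi; apply; rewrite -cE.
have r0 : amplitude cls tau i./2 t != 0 by rewrite gt_eqF// expR_gt0.
by case: (odd i); apply/eqP; [move/eqP: c2|move/eqP: c1];
  rewrite mulf_eq0 (negbTE r0).
Qed.

(** * Construction of the flow on the torus *)

Theorem theorem1p2 (R : realType) (m n : nat)
    (m_gt0 : (0 < m)%N) (n_gt0 : (0 < n)%N) (le_nm : (n <= m)%N) :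
  exists (M : smooth_manifold R n) (F : R -> M -> 'rV[R]_(2 * m)),
    [/\ compact [set: M],
        connected [set: M],
        ancient_mean_curvature_flow F
      & forall t : R, t < 0 ->
          forall (p : 'rV[R]_(2 * m)) (V : {vspace 'rV[R]_(2 * m)}),
            \dim V = (2 * m - 1)%N ->
            ~ (range (F t) `<=` affine_subspace p V)].
Proof.
case: n n_gt0 le_nm => // n _ le_nm.
(* The dimension is now [n.+1]. The first [n.+1] frequencies get one angle each and the others share
   the last; [le_nm] makes this onto. *)
pose cls j : 'I_n.+1 := inord (minn j n).
have cls_onto (a : 'I_n.+1) : exists j : 'I_m, cls j == a.
  exists (Ordinal (leq_trans (ltn_ord a) le_nm)).
  rewrite -val_eqE /= inordK ?ltnS ?geq_minr//.
  by apply/eqP/minn_idPl; rewrite -ltnS.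
have /choice[tau tauP] (a : 'I_n.+1) : exists tau_a : R -> R,
    forall t : R, t < 0 ->
    is_derive t 1 tau_a (\sum_(j < m) (cls j == a)%:R *
      (j.+1%:R * expR (- (j.+1%:R ^+ 2) * tau_a t)) ^+ 2)^-1.
  have [j0 j0a] := cls_onto a.
  exact: (@exponential_sum_flow R m (fun j => cls j == a) j0).
have speedP (a : 'I_n.+1) (t : R) : t < 0 ->
    is_derive t 1 (tau a) (speed2 m cls tau a t)^-1.
  move=> t0; rewrite [speed2 _ _ _ _ _](_ : _ = \sum_(j < m) (cls j == a)%:R *
      (j.+1%:R * expR (- (j.+1%:R ^+ 2) * tau a t)) ^+ 2); first exact: tauP.
  (* [amplitude] uses [tau (cls j)], which is [tau a] in the terms with nonzero weight. *)
  apply: eq_bigr => j _; rewrite /amplitude.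
  by have [->|_] := eqVneq (cls j) a; rewrite ?mul0r.
have speed_gt0 (a : 'I_n.+1) (t : R) : 0 < speed2 m cls tau a t.
  have [j0 j0a] := cls_onto a.
  rewrite /speed2 (bigD1 j0)//= j0a mul1r ltr_pwDl//.
    by rewrite exprn_gt0// mulr_gt0 ?expR_gt0.
  by apply: sumr_ge0 => j _; rewrite mulr_ge0// sqr_ge0.
(* A lift to R^(n+1) is chosen for each point; [FE] shows that the choice is immaterial. *)
pose F (t : R) (z : torus_manifold R n.+1) : 'rV[R]_(2 * m) :=
  position m cls tau t (projT1 (cid (torus_pointP z))).
have FE t (u : 'rV[R]_n.+1) : F t (torus_point u) = position m cls tau t u.
  rewrite /F; case: cid => v /= /(congr1 set_val)[/rowP cuv /rowP suv].
  apply/rowP => i; rewrite !mxE; congr (_ * _); apply: wave_periodic.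
    by have := cuv (cls i./2); rewrite !mxE.
  by have := suv (cls i./2); rewrite !mxE.
exists (torus_manifold R n.+1), F; split.
- exact: torus_compact.
- exact: torus_connected.
- move=> p; have FEp t : F t \o param p = position m cls tau t.
    by apply/funext => u; exact: FE.
  split=> [|t u t0 pu|t u t0 pu].
  + rewrite (_ : (fun z => _) =
        fun z : R * 'rV[R]_n.+1 => position m cls tau z.1 z.2).
      exact: smooth_position (ball_open _ _).
    by apply/funext => z; exact: FE.
  + by rewrite FEp; exact: position_row_free.
  + rewrite FEp -derive_position_time//; congr (derive1 _ t).
    by apply/funext => s; exact: FE.
- move=> t t0 p V dimV FV; apply: (@position_full R n.+1 m cls tau t p V).
    by rewrite dimV subn1 prednK ?muln_gt0.
  by move=> u; rewrite -FE; apply: FV; exists (torus_point u).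
Qed.
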